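(* Let $G$ be a strongly topological gyrogroup with a symmetric neighborhood base $\mathscr U$ at $0$ and let $H$ be a second-countable admissible subgyrogroup of $G$ generated from $\mathscr U$. If the quotient space $G/H$ is an $\aleph_{0}$-space (respectively, a cosmic space), then $G$ is also an $\aleph_{0}$-space (respectively, a cosmic space).
   Context: All topological spaces are assumed to be Hausdorff. A gyrogroup is a set $G$ with a binary operation $\oplus$ such that: (G1) there is a unique identity element $0\in G$ with $0\oplus a=a=a\oplus 0$ for all $a\in G$; (G2) for each $x\in G$ there is a unique inverse $\ominus x\in G$ with $\ominus x\oplus x=0=x\oplus(\ominus x)$; (G3) for all $x,y\in G$ there is an automorphism $\mathrm{gyr}[x,y]$ of $(G,\oplus)$ with $x\oplus(y\oplus z)=(x\oplus y)\oplus \mathrm{gyr}[x,y](z)$ for all $z\in G$; (G4) $\mathrm{gyr}[x\oplus y,y]=\mathrm{gyr}[x,y]$ for all $x,y\in G$. A topological gyrogroup is a gyrogroup with a topology such that $\oplus:G\times G\to G$ is jointly continuous and $x\mapsto\ominus x$ is continuous. A strongly topological gyrogroup with a symmetric neighborhood base $\mathscr U$ at $0$ is a topological gyrogroup $G$ together with a neighborhood base $\mathscr U$ of $0$ such that for every $U\in\mathscr U$: $\ominus U=U$ and $\mathrm{gyr}[x,y](U)=U$ for all $x,y\in G$. A subgyrogroup of $G$ is a nonempty subset $H$ with $\ominus a\in H$ and $a\oplus b\in H$ for all $a,b\in H$; it is an $L$-subgyrogroup if moreover $\mathrm{gyr}[a,h](H)=H$ for all $a\in G$, $h\in H$. A subgyrogroup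 $H$ of $G$ is an admissible subgyrogroup generated from $\mathscr U$ if there is a sequence $\{U_n:n\in\omega\}$ of open symmetric neighborhoods of $0$ with each $U_n\in\mathscr U$, $U_{n+1}\oplus(U_{n+1}\oplus U_{n+1})\subset U_n$ for each $n\in\omega$, and $H=\bigcap_{n\in\omega}U_n$. Such an $H$ is known to be a closed $L$-subgyrogroup of $G$. For an $L$-subgyrogroup $H$, the set $G/H=\{a\oplus H:a\in G\}$ is a partition of $G$; it carries the quotient topology with respect to $\pi:G\to G/H$, $\pi(a)=a\oplus H$ (i.e. $O\subset G/H$ is open iff $\pi^{-1}(O)$ is open in $G$). Subsets such as $H$ carry the subspace topology. A family $\mathcal P$ of subsets of a space $X$ is a network for $X$ if whenever $x\in U$ with $U$ open in $X$ there is $P\in\mathcal P$ with $x\in P\subset U$; it is a $k$-network for $X$ if whenever $K\subset U$ with $K$ compact and $U$ open in $X$, there is a finite $\mathcal P'\subset\mathcal P$ with $K\subset\bigcup\mathcal P'\subset U$. A space is cosmic if it is regular and has a countable network; it is an $\aleph_0$-space if it is regular and has a countable $k$-network. *)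

(* Defs.v *)
From HB Require Import structures.
From mathcomp Require Import all_boot all_classical topology.

Set Implicit Arguments.
Unset Strict Implicit.
Unset Printing Implicit Defensive.

Local Open Scope classical_set_scope.

Declare Scope gyro_scope.
Delimit Scope gyro_scope with gyro.

Reserved Notation "x ⊕ y" (at level 50, left associativity).
Reserved Notation "⊖ x" (at level 35, right associativity).

(* [gyr x y] is data, but it is determined by the operation: left cancellation
   makes [gyr_assoc] fix its value at every point. *)
HB.mixin Record isGyrogroup G := {
  gyro0 : G;
  gyro_add : G -> G -> G;
  gyro_opp : G -> G;
  gyr : G -> G -> G -> G;
  gyro_add0x : forall a, gyro_add gyro0 a = a;
  gyro_addx0 : forall a, gyro_add a gyro0 = a;
  gyro0_uniq : forall e,
    (forall a, gyro_add e a = a /\ gyro_add a e = a) -> e = gyro0;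
  gyro_addNx : forall x, gyro_add (gyro_opp x) x = gyro0;
  gyro_addxN : forall x, gyro_add x (gyro_opp x) = gyro0;
  gyro_opp_uniq : forall x y,
    gyro_add y x = gyro0 -> gyro_add x y = gyro0 -> y = gyro_opp x;
  gyr_bij : forall x y, bijective (gyr x y);
  gyr_add : forall x y,
    {morph gyr x y : a b / gyro_add a b >-> gyro_add a b};
  gyr_assoc : forall x y z,
    gyro_add x (gyro_add y z) = gyro_add (gyro_add x y) (gyr x y z);
  gyr_loop : forall x y, gyr (gyro_add x y) y =1 gyr x y
}.

#[short(type="gyrogroupType")]
HB.structure Definition Gyrogroup := {G of isGyrogroup G}.

Notation "x ⊕ y" := (gyro_add x y) : gyro_scope.
Notation "⊖ x" := (gyro_opp x) : gyro_scope.
Local Open Scope gyro_scope.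

HB.mixin Record Gyrogroup_isTopological G & Gyrogroup G & Topological G := {
  gyro_add_continuous : continuous (fun xy : G * G => xy.1 ⊕ xy.2);
  gyro_opp_continuous : continuous (fun x : G => ⊖ x)
}.

#[short(type="topologicalGyrogroupType")]
HB.structure Definition TopologicalGyrogroup :=
  {G of Gyrogroup G & Topological G & Gyrogroup_isTopological G}.

Section gyrogroup.
Context {G : gyrogroupType}.
Implicit Types A B H : set G.

Definition gyro_addset A B : set G := [set a ⊕ b | a in A & b in B].

Definition subgyrogroup H :=
  [/\ H !=set0, (forall a, H a -> H (⊖ a)) &
      (forall a b, H a -> H b -> H (a ⊕ b))].

Definition gyro_lcoset H (a : G) : set G := [set a ⊕ h | h in H].

Definition gyro_cosets H : set (set G) := range (gyro_lcoset H).

End gyrogroup.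

(* The underlying type of G/H; it makes sense for every set H, and the cosets
   partition G when H is an L-subgyrogroup. *)
Definition coset_type (G : gyrogroupType) (H : set G) : Type := gyro_cosets H.

Section coset_quotient.
Context {G : gyrogroupType} (H : set G).

Definition coset_pi (a : G) : coset_type H :=
  exist _ (gyro_lcoset H a) (mem_set (imageT (gyro_lcoset H) a)).

Lemma coset_pi_surj (C : coset_type H) : exists a, coset_pi a = C.
Proof.
by case: C => C HC; have [a _ aC] := set_mem HC; exists a; exact: eq_exist.
Qed.

Definition coset_repr (C : coset_type H) : G := projT1 (cid (coset_pi_surj C)).

Lemma coset_reprK : cancel coset_repr coset_pi.
Proof. by move=> C; rewrite /coset_repr; case: cid. Qed.

HB.instance Definition _ := @isQuotient.Build G (coset_type H)
  coset_repr coset_pi coset_reprK.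

End coset_quotient.

(* By definition of [quotient_topology], a set of cosets is open iff its
   preimage under [coset_pi] is open in G. *)
Definition coset_space (G : topologicalGyrogroupType) (H : set G) :
  topologicalType := quotient_topology (coset_type H).

Section strongly_topological.
Context {G : topologicalGyrogroupType}.
Implicit Types (UU : set_system G) (H : set G).

Definition nbhs_base (x : G) UU :=
  UU `<=` nbhs x /\ forall V, nbhs x V -> exists2 U, UU U & U `<=` V.

Definition strongly_topological_gyrogroup UU :=
  nbhs_base gyro0 UU /\
  forall U, UU U ->
    gyro_opp @` U = U /\ forall x y : G, gyr x y @` U = U.

Definition admissible_subgyrogroup UU H :=
  subgyrogroup H /\
  exists U_ : nat -> set G,
    [/\ forall n, [/\ open_nbhs gyro0 (U_ n), gyro_opp @` U_ n = U_ n
                    & UU (U_ n)],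
        forall n, gyro_addset (U_ n.+1) (gyro_addset (U_ n.+1) (U_ n.+1))
                    `<=` U_ n
      & H = \bigcap_n U_ n].

End strongly_topological.

Section networks.
Context {X : topologicalType}.
Implicit Types (P : set (set X)).

Definition network P := forall (x : X) (U : set X), open U -> U x ->
  exists A, [/\ P A, A x & A `<=` U].

Definition k_network P := forall K U : set X, compact K -> open U -> K `<=` U ->
  exists P', [/\ finite_set P', P' `<=` P, K `<=` \bigcup_(A in P') A
               & \bigcup_(A in P') A `<=` U].

End networks.

(* Spaces are Hausdorff by convention and [regular_space] does not include any
   separation of points, hence the explicit [hausdorff_space]. *)
Definition cosmic_space (X : topologicalType) :=
  [/\ hausdorff_space X, regular_space X &
      exists2 P : set (set X), countable P & network P].

Definition aleph0_space (X : topologicalType) :=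
  [/\ hausdorff_space X, regular_space X &
      exists2 P : set (set X), countable P & k_network P].

(* Main.v *)
(* Let [pi : G -> G/H] and let [D] be countable and dense in [G].  Since [H] is
   second countable, there are countably many [V] in [UU] whose traces
   [V ⊕ (V ⊕ V) `&` H] are arbitrarily small.  If [z] lies in
   [N = b ⊕ V], a neighborhood of [x], and [pi z = pi q] with [q] close to [x],
   then [z = q ⊕ h] for some [h] in that trace, so [z] is close to [x].  Thus
   for every open [O] containing [x] some member [N] of the countable family of
   all [b ⊕ V] with [b] in [D], and some neighborhood [Q] of [x], satisfy
   [N `&` pi @^-1` (pi @` Q) `<=` O]; hence the sets [N `&` pi @^-1` A], for
   [A] in a countable (k-)network of [G/H], form a (k-)network of [G].  Since the
   members of [UU] and [H] are invariant under gyrations, [⊕] behaves on them as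
   an associative operation. *)
Require Import Defs.
From HB Require Import structures.
From mathcomp Require Import all_boot all_classical topology.

Local Open Scope classical_set_scope.
Local Open Scope gyro_scope.

(** * Compactness and countability *)

(** Finite subfamilies of [P] are directed by inclusion. Near-covering compactness, applied to the
    filter of tails [above F], turns the local covers into one finite subfamily. *)
Lemma compact_finite_cover (X : topologicalType) (K : set X)
    (P : set (set X)) :
  compact K ->
  (forall x, K x -> exists C F, [/\ nbhs x C, finite_set F, F `<=` P
                                  & K `&` C `<=` \bigcup_(A in F) A]) ->
  exists F, [/\ finite_set F, F `<=` P & K `<=` \bigcup_(A in F) A].
Proof.
move=> cK locK.
pose fin := [set F : set (set X) | finite_set F /\ F `<=` P].
pose above F := [set F' | fin F' /\ F `<=` F'].
have fF : Filter (filter_from fin above).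
  apply: filter_from_filter.
    by exists set0; split => //; exact: finite_set0.
  move=> F1 F2 [fF1 F1P] [fF2 F2P]; exists (F1 `|` F2).
    by split; [rewrite finite_setU|move=> A []; [exact: F1P|exact: F2P]].
  by move=> F' [finF' sF12]; split; split => //;
    apply: subset_trans sF12 => A FA; [left|right].
have := (compact_near_coveringP K).1 cK _ _
  (fun F x => K x -> (\bigcup_(A in F) A) x) fF.
case=> [x Kx|F0 finF0 F0K].
  have [C [F [nC finF FP KCF]]] := locK _ Kx.
  exists (C, above F); first by split => //=; exists F.
  move=> [y F'] [/= Cy [_ FF']] Ky.
  by have [//|A FA Ay] := KCF y; exists A => //; exact: FF'.
exists F0; split; [exact: finF0.1|exact: finF0.2|].
by move=> x Kx; apply: (F0K F0) => //; split.
Qed.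

Lemma countable_image2 (S T U : Type) (f : S -> T -> U) (A : set S)
    (B : set T) :
  countable A -> countable B -> countable [set f x y | x in A & y in B].
Proof.
move=> cA cB; rewrite image2E.
exact: sub_countable (card_image_le _ _) (countableX cA cB).
Qed.

(** * Networks, density and bases *)

Section networks.
Context {X : topologicalType}.
Implicit Type P : set (set X).

Lemma network_dense P :
  countable P -> network P -> exists2 D : set X, countable D & dense D.
Proof.
move=> cP nP.
have /choice[f fP] (A : set X) : exists B,
    [/\ countable B, B `<=` A & A !=set0 -> B !=set0].
  have [[a Aa]|A0] := pselect (A !=set0).
    by by exists [set a]; split => [|_ ->//|_]; [exact: countable1|exists a].
  by exists set0; split => //; exact: countable0.
exists (\bigcup_(A in P) f A).
  by apply: bigcup_countable => // A _; have [] := fP A.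
move=> O [x Ox] oO; have [A [PA Ax AO]] := nP _ _ oO Ox.
have [_ fA /(_ (ex_intro _ x Ax))[y fAy]] := fP A.
by exists y; split; [exact/AO/fA|exists A].
Qed.

Lemma basis_network P : basis P -> network P.
Proof.
move=> [_ bP] x U oU Ux.
have [|A [PA Ax] AU] := bP x U; first exact: open_nbhs_nbhs.
by exists A.
Qed.

Lemma k_network_network P : k_network P -> network P.
Proof.
move=> kP x U oU Ux.
have [|P' [_ P'P xP' P'U]] := kP _ _ (@compact_set1 _ x) oU; first by move=> _ ->.
have [A P'A Ax] := xP' x erefl.
by exists A; split => //; [exact: P'P|move=> y Ay; apply: P'U; exists A].
Qed.

End networks.

(** * Pulling networks back along a continuous open map *)

Section network_pullback.
Context {X Y : topologicalType} (f : X -> Y) (M : set (set X)).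
Hypothesis f_cont : continuous f.
Hypothesis f_open : forall O, open O -> open (f @` O).
Hypothesis f_sep : forall x O, open O -> O x -> exists N Q,
  [/\ M N, nbhs x N, open Q, Q x & N `&` f @^-1` (f @` Q) `<=` O].

Definition pullback_network (P : set (set Y)) : set (set X) :=
  [set N `&` f @^-1` A | N in M & A in P].

Lemma network_pullback P : network P -> network (pullback_network P).
Proof.
move=> nP x O oO Ox; have [N [Q [MN nN oQ Qx NQ]]] := f_sep _ _ oO Ox.
have [|A [PA Afx AQ]] := nP (f x) _ (f_open _ oQ); first by exists x.
exists (N `&` f @^-1` A); split; first by exists N => //; exists A.
  by split => //; exact: nbhs_singleton.
by move=> z [Nz /AQ Qz]; exact: NQ.
Qed.

Lemma k_network_pullback P : regular_space X ->
  k_network P -> k_network (pullback_network P).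
Proof.
move=> rX kP K O cK oO KO.
pose PO := [set B | pullback_network P B /\ B `<=` O].
have [x Kx|F [finF FP KF]] := compact_finite_cover _ _ PO cK; last first.
  exists F; split => // [B /FP[]//|]; by apply: bigcup_sub => B /FP[].
have [N [Q [MN nN oQ Qx NQ]]] := f_sep _ _ oO (KO _ Kx).
have [C nC CNQ] : filter_from (nbhs x) closure (N `&` Q).
  by apply: rX; apply: filterI => //; exact: open_nbhs_nbhs.
have cfK : compact (f @` (K `&` closure C)).
  apply: continuous_compact; first exact: continuous_subspaceT.
  by apply: compact_closedI => //; exact: closed_closure.
have [|F [finF FP KF FQ]] := kP _ _ cfK (f_open _ oQ).
  by move=> _ [y [_ /CNQ[_ Qy]] <-]; exists y.
exists C, [set N `&` f @^-1` A | A in F]; split => //.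
- exact: finite_image.
- move=> _ [A FA <-]; split; first by exists N => //; exists A => //; exact: FP.
  by move=> z [Nz Az]; apply: NQ; split => //; apply: FQ; exists A.
- move=> y [Ky /subset_closure Cy].
  have [|A FA Afy] := KF (f y); first by exists y.
  exists (N `&` f @^-1` A); first by exists A.
  by split => //; exact: (CNQ _ Cy).1.
Qed.

End network_pullback.

(** * Gyrogroup algebra and gyration-invariant sets *)

Section gyrogroup.
Context {G : gyrogroupType}.
Implicit Types (a b x y z : G) (A B H : set G).

(** Injectivity of gyrations gives left cancellation. The loop property then replaces [gyr (⊖ a) a]
    by [gyr gyro0 a], which cancellation shows to be the identity. *)
Lemma gyro_addK a b : ⊖ a ⊕ (a ⊕ b) = b.
Proof.
have addI (c u v : G) : c ⊕ u = c ⊕ v -> u = v.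
  move=> /(congr1 (gyro_add (⊖ c))); rewrite !gyr_assoc gyro_addNx !gyro_add0x.
  exact/bij_inj/gyr_bij.
rewrite gyr_assoc -gyr_loop gyro_addNx gyro_add0x.
apply: (addI a).
by rewrite -[a in a ⊕ gyr _ _ _]gyro_add0x -gyr_assoc gyro_add0x.
Qed.

Lemma gyro_addI a : injective (gyro_add a).
Proof. exact: can_inj (gyro_addK a). Qed.

Lemma gyro_addKN a b : a ⊕ (⊖ a ⊕ b) = b.
Proof. by apply: (gyro_addI (⊖ a)); rewrite gyro_addK. Qed.

(** Equality, not mere inclusion, lets any element of [A] be written as a gyration of another
    element of [A]. *)
Definition gyr_stable A := forall x y, gyr x y @` A = A.

Lemma lcosetP A x z : gyro_lcoset A x (x ⊕ z) -> A z.
Proof. by case=> a Aa /gyro_addI <-. Qed.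

Lemma lcosetE A x : gyro_lcoset A x = (fun z => ⊖ x ⊕ z) @^-1` A.
Proof.
apply/seteqP; split => [_ [a Aa <-]|z Az]; first by rewrite /= gyro_addK.
by exists (⊖ x ⊕ z) => //; rewrite gyro_addKN.
Qed.

Lemma sub_lcoset A B x : A `<=` B -> gyro_lcoset A x `<=` gyro_lcoset B x.
Proof. exact: image_subset. Qed.

(** A triangle inequality, with [gyro_lcoset A x y] read as [y] being [A]-close to [x]. Writing the
    second increment as [gyr x a c] with [c] in [B] makes [gyr_assoc] applicable. *)
Lemma lcoset_add A B x y z : gyr_stable B ->
  gyro_lcoset A x y -> gyro_lcoset B y z -> gyro_lcoset (gyro_addset A B) x z.
Proof.
move=> sB [a Aa <-] [b + <-]; rewrite -{1}(sB x a) => -[c Bc <-].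
by exists (a ⊕ c); [exists a => //; exists c|rewrite gyr_assoc].
Qed.

Lemma lcoset_sym A x y : gyr_stable A -> (forall a, A a -> A (⊖ a)) ->
  gyro_lcoset A x y -> gyro_lcoset A y x.
Proof.
move=> sA oA [a Aa <-]; exists (gyr x a (⊖ a)).
  by rewrite -(sA x a); exists (⊖ a) => //; exact: oA.
by rewrite -gyr_assoc gyro_addxN gyro_addx0.
Qed.

Lemma addset_stable A B :
  gyr_stable A -> gyr_stable B -> gyr_stable (gyro_addset A B).
Proof.
move=> sA sB x y; apply/seteqP; split.
  move=> _ [_ [a Aa [b Bb <-]] <-]; exists (gyr x y a).
    by rewrite -(sA x y); exists a.
  exists (gyr x y b); first by rewrite -(sB x y); exists b.
  by rewrite gyr_add.
move=> _ [a + [b + <-]]; rewrite -{1}(sA x y) -{1}(sB x y).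
move=> -[a' Aa' <-] [b' Bb' <-].
by exists (a' ⊕ b'); [exists a' => //; exists b'|rewrite gyr_add].
Qed.

Lemma bigcap_stable (J : Type) (U_ : J -> set G) :
  (forall i, gyr_stable (U_ i)) -> gyr_stable (\bigcap_i U_ i).
Proof.
move=> sU x y; apply/seteqP; split.
  by move=> _ [a Ua <-] i _; rewrite -(sU i x y); exists a => //; exact: Ua.
(* By injectivity the preimages of [a] found in the various [U_ i] are all the same point [g a]. *)
have [g gyrK gK] := gyr_bij x y.
move=> a Ua; exists (g a) => // i _.
by have := Ua i I; rewrite -{1}(sU i x y) => -[b Ub <-]; rewrite gyrK.
Qed.

Section cosets.
Context (H : set G).
Hypotheses (sgH : subgyrogroup H) (sH : gyr_stable H).

Lemma subgyrogroup0 : H gyro0.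
Proof.
have [[a Ha] oH aH] := sgH; rewrite -(gyro_addxN a).
by apply: aH => //; exact: oH.
Qed.

Lemma lcoset_subgyro_trans x y z :
  gyro_lcoset H x y -> gyro_lcoset H y z -> gyro_lcoset H x z.
Proof.
move=> xy yz; have := lcoset_add _ _ _ _ _ sH xy yz.
apply: sub_lcoset => _ [a Ha [b Hb <-]]; by have [_ _] := sgH; exact.
Qed.

Lemma coset_piP x y : coset_pi H x = coset_pi H y <-> gyro_lcoset H x y.
Proof.
split=> [/(congr1 sval) /= ->|xy].
  by exists gyro0; [exact: subgyrogroup0|rewrite gyro_addx0].
have yx : gyro_lcoset H y x.
  by apply: lcoset_sym => //; have [_ + _] := sgH.
by apply: eq_exist; apply/seteqP; split => z; exact: lcoset_subgyro_trans.
Qed.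

End cosets.

End gyrogroup.

(** * Translations and the quotient map *)

Section topological_gyrogroup.
Context {G : topologicalGyrogroupType}.
Implicit Types (x y z : G) (O W : set G).

Lemma continuous_gyro_addl a : continuous (fun x : G => a ⊕ x).
Proof.
move=> x; apply: (cvg_comp2 (cvg_cst a) cvg_id).
exact: (gyro_add_continuous (a, x)).
Qed.

Lemma continuous_gyro_addr a : continuous (fun x : G => x ⊕ a).
Proof.
move=> x; apply: (cvg_comp2 cvg_id (cvg_cst a)).
exact: (gyro_add_continuous (x, a)).
Qed.

Lemma nbhs_lcoset x W : nbhs gyro0 W -> nbhs x (gyro_lcoset W x).
Proof.
move=> nW; rewrite lcosetE; apply: continuous_gyro_addl.
by rewrite gyro_addNx.
Qed.

Section quotient.
Context (H : set G).
Hypotheses (sgH : subgyrogroup H) (sH : gyr_stable H).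

Lemma coset_openE (A : set (coset_space H)) :
  open A = open (coset_pi H @^-1` A).
Proof. by rewrite {1}/open /= /quotient_open unlock. Qed.

Lemma coset_pi_continuous :
  continuous (coset_pi H : G -> coset_space H).
Proof. by apply/continuousP => A; rewrite coset_openE. Qed.

(** If [z ⊕ h] lies in [O] with [h] in [H], so does [y ⊕ h] for [y] near [z], and [y ⊕ h] is in the
    coset of [y]. *)
Lemma coset_pi_open O :
  open O -> open ((coset_pi H : G -> coset_space H) @` O).
Proof.
move=> oO; rewrite coset_openE openE => z [q Oq /(coset_piP _ sgH sH)].
have oH : forall a, H a -> H (⊖ a) by have [] := sgH.
move=> /(lcoset_sym _ _ _ sH oH)[h Hh zhq].
have : nbhs z [set y | O (y ⊕ h)].
  apply: continuous_gyro_addr; rewrite zhq.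
  exact: open_nbhs_nbhs.
apply: filterS => y Oyh; exists (y ⊕ h) => //.
by apply/esym/(coset_piP _ sgH sH); exists h.
Qed.

(** The dense set of G/H supplies a coset meeting [O]. Left translation by its representative pulls
    [O] back to a nonempty open subset of [H], which meets [E]. *)
Lemma coset_dense :
  (exists2 D : set (coset_space H), countable D & dense D) ->
  (exists2 E : set (set_type H), countable E & dense E) ->
  exists2 D : set G, countable D & dense D.
Proof.
move=> [D cD dD] [E cE dE].
exists [set coset_repr d ⊕ set_val e | d in D & e in E].
  exact: countable_image2.
move=> O [x Ox] oO.
have [||d [[y Oy yd] Dd]] := dD (coset_pi H @` O).
- by exists (coset_pi H x); exists x.
- exact: coset_pi_open.
have /(coset_piP _ sgH sH) [h Hh rhy] :
    coset_pi H (coset_repr d) = coset_pi H y.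
  by rewrite yd; exact: coset_reprK.
have [||e [Oe Ee]] := dE [set e | O (coset_repr d ⊕ set_val e)].
- by exists (exist _ h (mem_set Hh)); rewrite /= rhy.
- have /continuousP cadd := continuous_gyro_addl (coset_repr d).
  by exists (gyro_add (coset_repr d) @^-1` O) => //; exact: cadd.
- by exists (coset_repr d ⊕ set_val e); split => //; exists d => //; exists e.
Qed.

End quotient.

(** * Consequences of a symmetric gyration-invariant base *)

Section strong.
Context {UU : set_system G}.
Hypothesis sUU : strongly_topological_gyrogroup UU.

Lemma strong_nbhs U : UU U -> nbhs gyro0 U.
Proof. by move: sUU => [[+ _] _]; apply. Qed.

Lemma strong_stable U : UU U -> gyr_stable U.
Proof. by move: sUU => [_ /(_ U)] + UUU => /(_ UUU)[]. Qed.

Lemma strong_sym U x y : UU U -> gyro_lcoset U x y -> gyro_lcoset U y x.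
Proof.
move=> UUU; apply: lcoset_sym; first exact: strong_stable.
have [_ /(_ U UUU)[oU _]] := sUU.
by move=> a Ua; rewrite -oU; exists a.
Qed.

Lemma strong_half W :
  nbhs gyro0 W -> exists2 V, UU V & gyro_addset V V `<=` W.
Proof.
move=> nW; have [[_ bUU] _] := sUU.
have [|[A B] /= [nA nB] ABW] := gyro_add_continuous (gyro0, gyro0) W.
  by rewrite /= gyro_addx0.
have [V UUV VAB] := bUU _ (filterI nA nB).
exists V => // _ [a Va [b Vb <-]]; apply: (ABW (a, b)).
by split; [exact: (VAB _ Va).1|exact: (VAB _ Vb).2].
Qed.

Lemma addset_subr (A B : set G) : nbhs gyro0 A -> B `<=` gyro_addset A B.
Proof.
move=> /nbhs_singleton A0 b Bb.
by exists gyro0 => //; exists b => //; rewrite gyro_add0x.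
Qed.

Lemma strong_third W : nbhs gyro0 W ->
  exists2 V, UU V & gyro_addset V (gyro_addset V V) `<=` W.
Proof.
move=> /strong_half[A UUA AW].
have [V UUV VA] := strong_half _ (strong_nbhs _ UUA).
exists V => // _ [a Va [b Vb <-]]; apply: AW.
exists a; last by exists b => //; exact: VA.
by apply: VA; apply: addset_subr => //; exact: strong_nbhs.
Qed.

Lemma strong_lcoset x O :
  nbhs x O -> exists2 W, UU W & gyro_lcoset (gyro_addset W W) x `<=` O.
Proof.
move=> nO; have [|W UUW WO] := strong_half ((fun z => x ⊕ z) @^-1` O).
  by apply: continuous_gyro_addl; rewrite gyro_addx0.
by exists W => // _ [w /WO + <-].
Qed.

Lemma strong_regular : regular_space G.
Proof.
move=> x O /strong_lcoset[W UUW WO].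
exists (gyro_lcoset W x); first exact/nbhs_lcoset/strong_nbhs.
(* A point [z] of the closure shares some [y] with [x ⊕ W]. By symmetry [z] is two [W]-steps from
   [x], hence in [O]. *)
move=> z /(_ _ (nbhs_lcoset z _ (strong_nbhs _ UUW)))[y [Wxy Wzy]].
apply: WO; apply: lcoset_add Wxy _; first exact: strong_stable.
exact: strong_sym.
Qed.

(** Each basic neighborhood of the identity in [H] is the trace of an open set of [G], into which a
    triple sum of some member of [UU] fits. One such member per basic set suffices. *)
Lemma second_countable_traces (H : set G) : H gyro0 ->
  @second_countable (set_type H) ->
  exists VV, [/\ countable VV, VV `<=` UU & forall W, nbhs gyro0 W ->
    exists2 V, VV V & gyro_addset V (gyro_addset V V) `&` H `<=` W].
Proof.
move=> H0 [B cB [oB bB]]; pose o : set_type H := exist _ gyro0 (mem_set H0).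
have /choice[f fP] (A : set (set_type H)) : exists V, B A -> A o ->
    UU V /\ gyro_addset V (gyro_addset V V) `&` H `<=` set_val @` A.
  have [[BA Ao]|nA] := pselect (B A /\ A o); last first.
    (* A dummy value: only basic sets containing [o] enter the image of [f] taken below. *)
    by exists set0 => BA Ao; case: nA.
  have [O oO OA] := oB _ BA.
  have Oo : O gyro0 by move: Ao; rewrite -OA.
  have [|V UUV VO] := strong_third O; first exact: open_nbhs_nbhs.
  exists V => _ _; split => // z [/VO Oz Hz].
  by exists (exist _ z (mem_set Hz)) => //; rewrite -OA.
exists (f @` (B `&` [set A | A o])); split.
- apply: sub_countable (card_image_le _ _) _; apply: sub_countable cB.
  by apply: subset_card_le => A [].
- by move=> _ [A [BA Ao] <-]; exact: (fP A BA Ao).1.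
move=> W nW.
have [|A [BA Ao] AW] := bB o (set_val @^-1` W).
  exact: (@initial_continuous (set_type H) G set_val).
exists (f A); first by exists A.
by move=> z /(fP A BA Ao).2[a /AW Wa <-].
Qed.

(** Only [N] has to come from a fixed family, countable when [VV] and [D] are; [Q] may depend freely
    on [x] and [O]. *)
Lemma coset_pi_separation (H : set G) (VV : set (set G)) (D : set G) :
  subgyrogroup H -> gyr_stable H -> VV `<=` UU ->
  (forall W, nbhs gyro0 W ->
    exists2 V, VV V & gyro_addset V (gyro_addset V V) `&` H `<=` W) ->
  dense D ->
  forall x O, open O -> O x -> exists N Q,
    [/\ [set gyro_lcoset V b | V in VV & b in D] N, nbhs x N, open Q, Q x
      & N `&` coset_pi H @^-1` (coset_pi H @` Q) `<=` O].
Proof.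
move=> sgH sH VVU VVH dD x O oO Ox.
have [|W UUW WO] := strong_lcoset x O; first exact: open_nbhs_nbhs.
have [V VVV VHW] := VVH _ (strong_nbhs _ UUW); have UUV := VVU _ VVV.
have nV := strong_nbhs _ UUV; have sV := strong_stable _ UUV.
(* Halving [V] allows the center to move from [x] to a point [b] of [D]: if [b] is [A]-close to [x],
   then [x ⊕ A] lies in [b ⊕ V], which is therefore still a neighborhood of [x]. *)
have [A UUA AAV] := strong_half _ nV.
have nA := strong_nbhs _ UUA; have sA := strong_stable _ UUA.
have [b [xAb Db]] : (gyro_lcoset A x)° `&` D !=set0.
  apply: dD; last exact: open_interior.
  by exists x; exact: nbhs_lcoset.
have bAx : gyro_lcoset A b x by apply: strong_sym => //; exact: interior_subset.
have AbV : gyro_lcoset A x `<=` gyro_lcoset V b.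
  by move=> y xAy; apply: sub_lcoset AAV _ _; exact: lcoset_add xAy.
have nVW : nbhs gyro0 (V `&` W) by apply: filterI => //; exact: strong_nbhs.
exists (gyro_lcoset V b), (gyro_lcoset (V `&` W) x)°; split.
- by exists V => //; exists b.
- by apply: (filterS AbV); exact: nbhs_lcoset.
- exact: open_interior.
- exact: (nbhs_lcoset x _ nVW).
move=> z [bVz [q /interior_subset xq /(coset_piP _ sgH sH)[h Hh qhz]]].
(* The path from [q] to [x] to [b] to [z] takes three [V]-steps, so cancelling [q] in [z = q ⊕ h]
   puts [h] in the triple sum, hence in [W]. The path from [x] to [q] to [z] then takes two
   [W]-steps. This is why [Q] is built from both [V] and [W]. *)
have xVb : gyro_lcoset V x b.
  apply: strong_sym => //; apply: AbV.
  by apply: nbhs_singleton; exact: nbhs_lcoset.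
have xVVz := lcoset_add _ _ _ _ _ sV xVb bVz.
have qVx : gyro_lcoset V q x.
  by apply: strong_sym => //; apply: sub_lcoset xq; exact: subIsetl.
have qz := lcoset_add _ _ _ _ _ (addset_stable _ _ sV sV) qVx xVVz.
have Wh : W h by apply: VHW; split => //; apply: (lcosetP _ q); rewrite qhz.
apply: WO; apply: (@lcoset_add _ _ _ _ q); first exact: strong_stable.
  by apply: sub_lcoset xq; exact: subIsetr.
by rewrite -qhz; exists h.
Qed.

End strong.

End topological_gyrogroup.

(** * Transfer of networks from G/H to G *)

Theorem corollary3p7 (G : topologicalGyrogroupType) (UU : set_system G)
    (H : set G) :
  hausdorff_space G ->
  strongly_topological_gyrogroup UU ->
  admissible_subgyrogroup UU H ->
  @second_countable (set_type H) ->
  (aleph0_space (coset_space H) -> aleph0_space G) /\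
  (cosmic_space (coset_space H) -> cosmic_space G).
Proof.
move=> hG sUU [sgH [U_ [U_P _ HE]]] scH.
have rG := strong_regular sUU.
have sH : gyr_stable H.
  rewrite HE; apply: bigcap_stable => n.
  by apply: (strong_stable sUU); have [] := U_P n.
have [VV [cVV VVU VVH]] :=
  second_countable_traces sUU _ (subgyrogroup0 _ sgH) scH.
have piC := @coset_pi_continuous G H.
have piO := @coset_pi_open G H sgH sH.
have [B cB /basis_network nB] := scH.
(* Shared by both cases, since a k-network is a network: [P] makes G/H separable, the base [B] makes
   [H] separable, and together they give the dense set of centers in [G]. *)
have sepM (P : set (set (coset_space H))) : countable P -> network P ->
    exists2 M : set (set G), countable M &
      forall x O, open O -> O x -> exists N Q, [/\ M N, nbhs x N, open Q, Q x
        & N `&` coset_pi H @^-1` (coset_pi H @` Q) `<=` O].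
  move=> cP nP.
  have [||D cD dD] := coset_dense _ sgH sH.
  - exact: (network_dense _ cP nP).
  - exact: (network_dense _ cB nB).
  exists [set gyro_lcoset V b | V in VV & b in D]; first exact: countable_image2.
  exact: (coset_pi_separation sUU _ _ _ sgH sH VVU VVH dD).
split=> -[_ _ [P cP nP]]; split => //.
- have [M cM sM] := sepM P cP (k_network_network _ nP).
  exists (@pullback_network G (coset_space H) (coset_pi H) M P).
    exact: countable_image2.
  exact: (@k_network_pullback _ _ _ _ piC piO sM _ rG nP).
- have [M cM sM] := sepM P cP nP.
  exists (@pullback_network G (coset_space H) (coset_pi H) M P).
    exact: countable_image2.
  exact: (@network_pullback _ _ _ _ piO sM _ nP).
Qed.
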